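(* Let $p,q$ be relatively prime nonzero integers. The average of the correction terms $d(L(p,q),\mathfrak s)$ over all spin$^{\mathbb C}$-structures $\mathfrak s\in Spin^{\mathbb C}(L(p,q))$ equals the Casson–Walker invariant $\lambda(L(p,q))$ of the lens space $L(p,q)$, i.e. $$\frac{1}{|p|}\sum_{\mathfrak s\in Spin^{\mathbb C}(L(p,q))} d(L(p,q),\mathfrak s)=\lambda(L(p,q)).$$
   Context: Heegaard Floer correction terms. For a rational homology $3$-sphere $Y$ with a spin$^{\mathbb C}$-structure $\mathfrak s$, $d(Y,\mathfrak s)\in\mathbb Q$ denotes the Heegaard Floer correction term of Ozsváth and Szabó; it satisfies $d(-Y,\mathfrak s)=-d(Y,\mathfrak s)$. The lens space $L(p,q)$ is oriented so that it is $p/q$-surgery on the unknot in $S^3$; one has $L(-p,q)\cong L(p,-q)\cong -L(p,q)$. For $p>0$ the set $Spin^{\mathbb C}(L(p,q))$ is identified with $H^2(L(p,q);\mathbb Z)\cong\mathbb Z/p\mathbb Z$ by the Ozsváth–Szabó labelling, and one writes $d(L(p,q),n)$ for $n\in\mathbb Z/p\mathbb Z$. For $p>0$ these numbers depend on $q$ and $n$ only modulo $p$ (since $L(p,q+kp)\cong L(p,q)$ for $k\in\mathbb Z$), satisfy $d(L(1,1),0)=0$, and by a theorem of Ozsváth and Szabó satisfy, for all relatively prime $0<q<p$ and $0\le n<p+q$, $$d(L(p,q),n)+d(L(q,p),n)=\frac14+\frac{n^2}{pq}+n\left(\frac1{pq}-\frac1q-\frac1p\right)+\frac14\left(\frac pq+\frac1{pq}+\frac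 qp\right)-\frac1{2q}-\frac1{2p}.$$ These properties determine all $d(L(p,q),n)$ for relatively prime $p>0$ and $q$. Casson–Walker invariant. $\lambda(Y)\in\mathbb Q$ is the Casson–Walker invariant of a rational homology sphere, with $\lambda(-Y)=-\lambda(Y)$, in the normalization for which $\lambda(S^3_{p/q}(K))=\lambda(L(p,q))-\frac qp\Delta_K''(1)$ for $p/q$-surgery on a knot $K\subset S^3$ with symmetrized Alexander polynomial $\Delta_K$, and for which (by Walker) $\lambda(L(p,q))=s(q,p)$ for relatively prime $p,q>0$. Here $s(q,p)=\sum_{k=0}^{p-1}\left(\left(\frac{kq}{p}\right)\right)\left(\left(\frac kp\right)\right)$ is the Dedekind sum, where $((x))=x-\lfloor x\rfloor-\frac12$ if $x\notin\mathbb Z$ and $((x))=0$ if $x\in\mathbb Z$. *)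

(* Defs.v *)
From HB Require Import structures.
From mathcomp Require Import all_boot all_order all_algebra.
Set Implicit Arguments.
Unset Strict Implicit.
Unset Printing Implicit Defensive.
Import Order.TTheory GRing.Theory Num.Theory.
Local Open Scope ring_scope.

(* Oriented rational homology 3-spheres Y, with orientation-preserving
   homeomorphisms, orientation reversal Y |-> -Y, the finite sets Spin^C(Y),
   and the lens spaces L(p,q) = S^3_{p/q}(unknot).  No 3-manifold theory is
   available, so these enter as an abstract signature.  The values [lens p q]
   are meaningful only for coprime p, q with p != 0; L(1,0) = S^3. *)
Record qhs3_theory := Qhs3Theory {
  qhs3 :> Type;
  homeo : qhs3 -> qhs3 -> Type;
  rev : qhs3 -> qhs3;
  spinc : qhs3 -> finType;
  spinc_homeo : forall Y Y', homeo Y Y' -> spinc Y -> spinc Y';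
  spinc_homeo_bij : forall Y Y' (h : homeo Y Y'), bijective (spinc_homeo h);
  spinc_rev : forall Y, spinc Y -> spinc (rev Y);
  spinc_rev_bij : forall Y, bijective (@spinc_rev Y);
  lens : int -> int -> qhs3;
  lens_shift : forall p q k : int, p != 0 -> coprimez p q ->
    homeo (lens p (q + k * p)) (lens p q);
  lens_oppl : forall p q : int, p != 0 -> coprimez p q ->
    homeo (lens (- p) q) (lens p (- q));
  lens_oppr : forall p q : int, p != 0 -> coprimez p q ->
    homeo (lens p (- q)) (rev (lens p q));
  (* The Ozsvath-Szabo labelling Z/p -> Spin^C(L(p,q)) for p > 0, as a
     function on representatives n : int.  ('Z_1 would be Z/2.) *)
  lens_label : forall p q : int, int -> spinc (lens p q);
  lens_label_eq : forall p q n m : int, 0 < p -> coprimez p q ->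
    (lens_label p q n = lens_label p q m) <-> (n = m %[mod p])%Z;
  lens_label_surj : forall p q : int, 0 < p -> coprimez p q ->
    forall s : spinc (lens p q), exists n : int, s = lens_label p q n
}.

(* Right-hand side of the Ozsvath-Szabo recursion. *)
Definition os_rhs (p q n : rat) : rat :=
  1 / 4 + n ^+ 2 / (p * q) + n * (1 / (p * q) - 1 / q - 1 / p)
  + 1 / 4 * (p / q + 1 / (p * q) + q / p) - 1 / (2 * q) - 1 / (2 * p).

(* The properties of the Heegaard Floer correction terms, which determine
   their values on lens spaces. *)
Record is_correction_term (T : qhs3_theory)
    (d : forall Y : T, spinc Y -> rat) : Prop := IsCorrectionTerm {
  d_homeo : forall (Y Y' : T) (h : homeo Y Y') (s : spinc Y),
    d Y' (spinc_homeo h s) = d Y s;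
  d_rev : forall (Y : T) (s : spinc Y), d (rev Y) (spinc_rev s) = - d Y s;
  d_lens_shift : forall p q k n : int, 0 < p -> coprimez p q ->
    d (lens T p (q + k * p)) (lens_label T p (q + k * p) n)
    = d (lens T p q) (lens_label T p q n);
  d_S3 : d (lens T 1 1) (lens_label T 1 1 0) = 0;
  d_recursion : forall p q n : int,
    0 < q -> q < p -> coprimez p q -> 0 <= n -> n < p + q ->
    d (lens T p q) (lens_label T p q n) + d (lens T q p) (lens_label T q p n)
    = os_rhs p%:~R q%:~R n%:~R
}.

Definition sawtooth (x : rat) : rat :=
  if x \is a Num.int then 0 else x - (Num.floor x)%:~R - 1 / 2.

Definition dedekind_sum (q p : int) : rat :=
  \sum_(k < `|p|%N)
    sawtooth (k%:R * q%:~R / p%:~R) * sawtooth (k%:R / p%:~R).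

(* The Casson-Walker invariant; its normalization is fixed by Walker's formula
   for lens spaces (so L(p,q), p, q > 0, has invariant s(q,p)). *)
Record is_casson_walker (T : qhs3_theory) (lambda : T -> rat) : Prop :=
    IsCassonWalker {
  lambda_homeo : forall Y Y' : T, homeo Y Y' -> lambda Y = lambda Y';
  lambda_rev : forall Y : T, lambda (rev Y) = - lambda Y;
  lambda_lens : forall p q : int, 0 < p -> 0 < q -> coprimez p q ->
    lambda (lens T p q) = dedekind_sum q p
}.

(* Main.v *)
Require Import Defs.
From HB Require Import structures.
From mathcomp Require Import all_boot all_order all_algebra.
From mathcomp Require Import ring zify.
Import Order.TTheory GRing.Theory Num.Theory.
Local Open Scope ring_scope.

(** Write f n = d(L(p,q),n) and g n = d(L(q,p),n), of periods p and q.
    Subtracting the recursion at n from the recursion at n + q eliminates g and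
    gives f (n + q) - f n = (2n+1)/p - 1 for 0 <= n < p.  Summation by parts
    along the orbit 0, q, 2q, ... modulo p then yields
      f 0 - avg f = 2 s(q,p) + 1/2 - 1/(2p),
    and symmetrically for g.  The recursion at n = 0 and Dedekind reciprocity
    give avg f + avg g = s(q,p) + s(p,q), so avg f = s(q,p) follows by the
    Euclidean algorithm. *)

Lemma sum_by_parts (g : nat -> rat) (n : nat) :
  \sum_(j < n) j%:R * (g j.+1 - g j)
  = (n%:R - 1) * g n + g 0%N - \sum_(j < n) g j.
Proof.
elim: n => [|n IH]; first by rewrite !big_ord0; ring.
by rewrite !big_ord_recr /= IH -natr1; ring.
Qed.

Lemma sum_ord_natr (n : nat) : \sum_(i < n) (i%:R : rat) = n%:R * (n%:R - 1) / 2.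
Proof.
elim: n => [|n IH]; first by rewrite big_ord0; field.
by rewrite big_ord_recr /= IH -natr1; field.
Qed.

Lemma sum_ord_sqr (n : nat) :
  \sum_(i < n) (i%:R : rat) ^+ 2 = (n%:R - 1) * n%:R * (2 * n%:R - 1) / 6.
Proof.
elim: n => [|n IH]; first by rewrite big_ord0; field.
by rewrite big_ord_recr /= IH -natr1; field.
Qed.

Section Coprime.
Variables p q : nat.
Hypotheses (p_gt0 : (0 < p)%N) (copq : coprime p q).

Lemma modn_mull_inj (i j : 'I_p) : (i * q = j * q %[mod p])%N -> i = j.
Proof.
wlog le_ij : i j / (i <= j)%N.
  by move=> W E; case: (leqP i j) => [|/ltnW] l; [exact: W | exact/esym/W].
move=> /eqP; rewrite eq_sym eqn_mod_dvd ?leq_mul2r ?le_ij ?orbT//.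
rewrite -mulnBl Gauss_dvdl// => dv; apply: val_inj => /=.
apply/eqP; rewrite eqn_leq le_ij /=; rewrite -subn_eq0.
by apply: contraLR dv; rewrite -lt0n => /gtnNdvd->//; have := ltn_ord j; lia.
Qed.

Lemma sum_modn_mull (h : nat -> rat) :
  \sum_(i < p) h ((i * q) %% p)%N = \sum_(i < p) h i.
Proof.
pose t (i : 'I_p) : 'I_p := Ordinal (ltn_pmod (i * q) p_gt0).
rewrite [RHS](reindex_inj (h := t))//.
by move=> i j [] /modn_mull_inj.
Qed.

Definition mod_moment : rat := \sum_(i < p) i%:R * ((i * q) %% p)%:R.
Definition div_moment : rat := \sum_(i < p) i%:R * ((i * q) %/ p)%:R.

Lemma natr_divn (i : nat) :
  ((i * q) %/ p)%:R = (i%:R * q%:R - ((i * q) %% p)%:R) / p%:R :> rat.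
Proof.
have p0 : p%:R != 0 :> rat by rewrite pnatr_eq0 -lt0n.
apply: (mulIf p0); rewrite divfK // -!natrM {2}(divn_eq (i * q) p) natrD.
by rewrite addrK.
Qed.

Lemma mod_momentE :
  mod_moment = q%:R * ((p%:R - 1) * p%:R * (2 * p%:R - 1) / 6) - p%:R * div_moment.
Proof.
have p0 : p%:R != 0 :> rat by rewrite pnatr_eq0 -lt0n.
rewrite -sum_ord_sqr /div_moment !mulr_sumr -sumrB; apply: eq_bigr => i _.
by rewrite natr_divn; field.
Qed.

Lemma sum_divn :
  \sum_(i < p) ((i * q) %/ p)%:R = (q%:R - 1) * (p%:R - 1) / 2 :> rat.
Proof.
have p0 : p%:R != 0 :> rat by rewrite pnatr_eq0 -lt0n.
under eq_bigr do rewrite natr_divn.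
rewrite -mulr_suml sumrB (sum_modn_mull (fun n => n%:R)) -mulr_suml sum_ord_natr.
by field.
Qed.

Lemma sum_divn_sqr :
  p%:R ^+ 2 * (\sum_(i < p) ((i * q) %/ p)%:R ^+ 2)
  = (1 - q%:R ^+ 2) * ((p%:R - 1) * p%:R * (2 * p%:R - 1) / 6)
    + 2 * p%:R * q%:R * div_moment :> rat.
Proof.
have p0 : p%:R != 0 :> rat by rewrite pnatr_eq0 -lt0n.
rewrite -sum_ord_sqr mulrBl mul1r -{1}(sum_modn_mull (fun n => n%:R ^+ 2)).
rewrite /div_moment !mulr_sumr -sumrB -big_split /=; apply: eq_bigr => i _.
by rewrite natr_divn; field.
Qed.

End Coprime.

Lemma sum_ord_ltn (m n : nat) : (m <= n)%N ->
  \sum_(j < n) (if (j < m)%N then j%:R else 0) = m%:R * (m%:R - 1) / 2 :> rat.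
Proof.
move=> le_mn; rewrite -big_mkcond /= -sum_ord_natr.
by rewrite (big_ord_widen n (fun j => j%:R)).
Qed.

Lemma card_ord_gtn (m n : nat) : (m < n)%N ->
  \sum_(i < n) (m < i)%N%:R = n%:R - 1 - m%:R :> rat.
Proof.
elim: n => [//|n IH]; rewrite ltnS leq_eqVlt => /orP[/eqP->|lt_mn].
  rewrite big1 => [|i _]; first by rewrite -natr1; ring.
  by rewrite ltnNge -ltnS ltn_ord.
by rewrite big_ord_recr /= IH // lt_mn -(natr1 n) mulr1n; ring.
Qed.

(* Counts the lattice points [(i, j)] below the diagonal of the [p x q]
   rectangle, weighted by [j], by rows and by columns. *)
Lemma sum_divn_triangle (p q : nat) : (0 < p)%N -> (0 < q)%N -> coprime p q ->
  \sum_(i < p) ((i * q) %/ p)%:R * (((i * q) %/ p)%:R + 1)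
  = 2 * ((p%:R - 1) * (q%:R * (q%:R - 1) / 2) - div_moment q p) :> rat.
Proof.
move=> p_gt0 q_gt0 copq.
pose w (i : 'I_p) (j : 'I_q) : rat := if (j * p <= i * q)%N then j%:R else 0.
transitivity (2 * \sum_(i < p) \sum_(j < q) w i j).
  rewrite mulr_sumr; apply: eq_bigr => i _.
  have lt_aq : ((i * q) %/ p < q)%N by rewrite ltn_divLR // mulnC ltn_pmul2l.
  rewrite (eq_bigr (fun j : 'I_q =>
    if (j < ((i * q) %/ p).+1)%N then j%:R else 0)) => [|j _]; last first.
    by rewrite /w ltnS leq_divRL.
  by rewrite sum_ord_ltn // -natr1; field.
rewrite exchange_big /= -sum_ord_natr; congr (2 * _).
rewrite mulr_sumr /div_moment -sumrB; apply: eq_bigr => j _.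
have [j0|j_gt0] := posnP j.
  by rewrite j0 big1 => [|i _]; [ring | rewrite /w j0; case: leqP].
have lt_bp : ((j * p) %/ q < p)%N by rewrite ltn_divLR // mulnC ltn_pmul2l.
rewrite mulrC -mulrBr -card_ord_gtn // mulr_sumr; apply: eq_bigr => i _.
rewrite /w ltn_divLR // leq_eqVlt.
have -> /= : (j * p == i * q)%N = false.
  apply/eqP => E; have : (q %| j * p)%N by rewrite E dvdn_mull.
  by rewrite Gauss_dvdl 1?coprime_sym // gtnNdvd.
by case: ifP; rewrite ?mulr1 ?mulr0.
Qed.

Lemma floor_divn (a p : nat) : (0 < p)%N ->
  Num.floor (a%:R / p%:R : rat) = (a %/ p)%N.
Proof.
move=> p_gt0; have p0 : 0 < p%:R :> rat by rewrite ltr0n.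
apply: floor_def; rewrite intrD -!pmulrn natr1 ler_pdivlMr // ltr_pdivrMr //.
rewrite -!natrM ler_nat ltr_nat.
by rewrite -leq_divRL // leqnn /= -ltn_divLR.
Qed.

Lemma sawtooth_divn (a p : nat) : (0 < p)%N ->
  sawtooth (a%:R / p%:R)
  = if (p %| a)%N then 0 else (a %% p)%:R / p%:R - 1 / 2.
Proof.
move=> p_gt0; have p0 : p%:R != 0 :> rat by rewrite pnatr_eq0 -lt0n.
have E : a%:R / p%:R = (a %/ p)%:R + (a %% p)%:R / p%:R :> rat.
  by rewrite {1}(divn_eq a p) natrD natrM; field.
rewrite /sawtooth intrEfloor floor_divn // -pmulrn.
have -> : ((a %/ p)%:R == a%:R / p%:R :> rat) = (p %| a)%N.
  rewrite E -subr_eq0 opprD addNKr oppr_eq0 mulf_eq0 invr_eq0 (negPf p0) orbF.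
  by rewrite pnatr_eq0.
by case: ifP => // _; rewrite E; ring.
Qed.

Lemma sawtooth_addz (x : rat) (k : int) : sawtooth (x + k%:~R) = sawtooth x.
Proof.
rewrite /sawtooth rpredDr ?rpred_int //.
case: ifP => // _.
by rewrite floorDrz ?rpred_int // intrKfloor rmorphD /=; ring.
Qed.

Lemma dedekind_sum_shift (q k p : int) : p != 0 ->
  dedekind_sum (q + k * p) p = dedekind_sum q p.
Proof.
move=> p0; have p0' : p%:~R != 0 :> rat by rewrite intr_eq0.
apply: eq_bigr => i _; congr (_ * _).
rewrite -(sawtooth_addz (i%:R * q%:~R / p%:~R) (i%:Z * k)); congr sawtooth.
by rewrite rmorphD /= !rmorphM /= -pmulrn; field.
Qed.

Lemma dedekind_sumE (p q : nat) : (0 < p)%N -> coprime p q ->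
  dedekind_sum q p = mod_moment p q / p%:R ^+ 2 - (p%:R - 1) / 4.
Proof.
move=> p_gt0 copq; have p0 : p%:R != 0 :> rat by rewrite pnatr_eq0 -lt0n.
have E (i : 'I_p) :
    sawtooth (i%:R * q%:~R / p%:~R) * sawtooth (i%:R / p%:~R)
    = i%:R * ((i * q) %% p)%:R / p%:R ^+ 2 - i%:R / p%:R / 2
      - ((i * q) %% p)%:R / p%:R / 2 + 1 / 4 - (if i == 0%N :> nat then 1 / 4 else 0).
  rewrite -!pmulrn -[i%:R * q%:R]natrM !sawtooth_divn // Gauss_dvdl //.
  have [i0|i_gt0] := posnP i; first by rewrite i0 dvdn0 mod0n; field.
  by rewrite gtnNdvd // (modn_small (ltn_ord i)) //; field.
rewrite /dedekind_sum /= (eq_bigr _ (fun i _ => E i)).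
rewrite !sumrB big_split /= !sumrB -!mulr_suml.
rewrite (sum_modn_mull p q p_gt0 copq (fun n => n%:R)) sum_ord_natr sumr_const card_ord.
by rewrite -[\sum_(i < p) (if _ then _ else _)]big_mkcond (big_pred1 (Ordinal p_gt0)) //
   -mulr_natr /mod_moment; field.
Qed.

Lemma dedekind_reciprocity (p q : nat) : (0 < p)%N -> (0 < q)%N -> coprime p q ->
  dedekind_sum q p + dedekind_sum p q
  = - (1 / 4) + (p%:R / q%:R + q%:R / p%:R + 1 / (p%:R * q%:R)) / 12.
Proof.
move=> p_gt0 q_gt0 copq.
have p0 : p%:R != 0 :> rat by rewrite pnatr_eq0 -lt0n.
have q0 : q%:R != 0 :> rat by rewrite pnatr_eq0 -lt0n.
rewrite !dedekind_sumE // 1?coprime_sym // !mod_momentE //.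
have := sum_divn_triangle p q p_gt0 q_gt0 copq.
under eq_bigr do rewrite mulrDr mulr1 -expr2.
rewrite big_split /= sum_divn // => H.
have := sum_divn_sqr p q p_gt0 copq.
rewrite (canRL (addrK _) H) => {}H.
have {H} -> : div_moment q p = ((p%:R - 1) * (q%:R * (q%:R - 1) / 2)
   - (q%:R - 1) * (p%:R - 1) / 4
   - ((1 - q%:R ^+ 2) * ((p%:R - 1) * p%:R * (2 * p%:R - 1) / 6)
    + 2 * p%:R * q%:R * div_moment p q) / (2 * p%:R ^+ 2)).
  by rewrite -H; field.
by field; rewrite p0 q0.
Qed.

Lemma sum_of_increments (p q : nat) (f : nat -> rat) :
  (0 < p)%N -> coprime p q -> (forall n, f (n %% p)%N = f n) ->
  (forall n, (n < p)%N -> f (n + q)%N - f n = (2 * n%:R + 1) / p%:R - 1) ->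
  (\sum_(n < p) f n) / p%:R = f 0%N - 2 * dedekind_sum q p - 1 / 2 + 1 / (2 * p%:R).
Proof.
move=> p_gt0 copq f_mod f_step.
have p0 : p%:R != 0 :> rat by rewrite pnatr_eq0 -lt0n.
have := sum_by_parts (fun j => f (j * q)%N) p.
have -> : f (p * q)%N = f 0%N by rewrite -f_mod modnMr.
rewrite mul0n.
under [X in _ - X]eq_bigr do rewrite -f_mod.
rewrite (sum_modn_mull p q p_gt0 copq f).
rewrite (eq_bigr (fun j : 'I_p => 2 / p%:R * (j%:R * ((j * q) %% p)%:R)
    + (1 / p%:R - 1) * j%:R)) => [|j _]; last first.
  rewrite -(f_mod (j * q)%N) mulSn addnC -f_mod -modnDml f_mod f_step ?ltn_pmod //.
  by field.
rewrite big_split /= -!mulr_sumr sum_ord_natr -/(mod_moment p q) => H.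
have -> : \sum_(n < p) f n = p%:R * f 0%N - (2 / p%:R * mod_moment p q +
   (1 / p%:R - 1) * (p%:R * (p%:R - 1) / 2)) by rewrite H; ring.
by rewrite dedekind_sumE //; field.
Qed.

Section Lens.
Variables (T : qhs3_theory) (d : forall Y : T, spinc Y -> rat).
Hypothesis hd : is_correction_term d.

Definition dlens (p q : int) (n : nat) : rat :=
  d (lens T p q) (lens_label T p q n).

Lemma sum_spinc_lens (p : nat) (q : int) : (0 < p)%N -> coprimez p q ->
  \sum_(s : spinc (lens T p q)) d (lens T p q) s = \sum_(n < p) dlens p q n.
Proof.
move=> p_gt0 copq.
pose t (n : 'I_p) := lens_label T p q n.
have t_inj : injective t.
  move=> n m /lens_label_eq; rewrite !modz_nat !modn_small //.
  by move=> /(_ p_gt0 copq) [] /val_inj.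
rewrite (reindex t) //; apply: onW_bij.
apply: inj_card_bij => //; rewrite -(card_codom t_inj).
apply/subset_leq_card/subsetP => s _.
have [n ->] := lens_label_surj (p := p) p_gt0 copq s.
have r_lt : (`|(n %% p)%Z| < p)%N.
  by rewrite -ltz_nat gez0_abs ?modz_ge0 ?ltz_pmod // -?lt0n; lia.
apply/codomP; exists (Ordinal r_lt); apply/lens_label_eq => //=.
by rewrite gez0_abs ?modz_mod // modz_ge0; lia.
Qed.

Lemma dlens_mod (p : nat) (q : int) (n : nat) : (0 < p)%N -> coprimez p q ->
  dlens p q (n %% p)%N = dlens p q n.
Proof.
move=> p_gt0 copq; rewrite /dlens; congr (d _ _).
by apply/lens_label_eq => //; rewrite !modz_nat modn_mod.
Qed.

Lemma dlens_sum_reciprocity (p q : nat) : (0 < q)%N -> (q < p)%N -> coprime p q ->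
  (\sum_(n < p) dlens p q n) / p%:R + (\sum_(n < q) dlens q p n) / q%:R
  = dedekind_sum q p + dedekind_sum p q.
Proof.
move=> q_gt0 lt_qp copq; have p_gt0 := ltn_trans q_gt0 lt_qp.
have p0 : p%:R != 0 :> rat by rewrite pnatr_eq0 -lt0n.
have q0 : q%:R != 0 :> rat by rewrite pnatr_eq0 -lt0n.
have coqp : coprime q p by rewrite coprime_sym.
have rec n : (n < p + q)%N -> dlens p q n = os_rhs p%:R q%:R n%:R - dlens q p n.
  move=> lt_n; rewrite !pmulrn -(d_recursion hd (p := p) (q := q)) ?ltz_nat //.
  by rewrite addrK.
rewrite (sum_of_increments p q) //; last 2 first.
- by move=> n; apply: dlens_mod.
- move=> n lt_np; rewrite !rec ?ltn_add2r //; last exact: ltn_addr.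
  rewrite -[X in _ - X - _](dlens_mod q) // modnDr dlens_mod // natrD /os_rhs.
  by field; rewrite p0 q0.
rewrite (sum_of_increments q p) //; last 2 first.
- by move=> n; apply: dlens_mod.
- move=> n lt_nq.
  have rec' m : (m < p + q)%N -> dlens q p m = os_rhs p%:R q%:R m%:R - dlens p q m.
    by move/rec->; ring.
  rewrite !rec' ?(addnC n) ?ltn_add2l //; last exact: ltn_addl.
  rewrite -[X in _ - X - _](dlens_mod p) // modnDl dlens_mod // natrD /os_rhs.
  by field; rewrite p0 q0.
have R0 : dlens p q 0 = os_rhs p%:R q%:R 0 - dlens q p 0 by rewrite rec // addn_gt0 p_gt0.
have := dedekind_reciprocity p q p_gt0 q_gt0 copq => /(canRL (addrK _)) ->.
by rewrite R0 /os_rhs; field; rewrite p0 q0.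
Qed.

Lemma dlens_sum_shift (p : nat) (q k : int) : (0 < p)%N -> coprimez p q ->
  \sum_(n < p) dlens p (q + k * p) n = \sum_(n < p) dlens p q n.
Proof.
by move=> p_gt0 copq; apply: eq_bigr => n _; apply: (d_lens_shift hd).
Qed.

Lemma avg_dlens (p : nat) (q : int) : (0 < p)%N -> coprimez p q ->
  (\sum_(n < p) dlens p q n) / p%:R = dedekind_sum q p.
Proof.
elim/ltn_ind: p q => p IH q p_gt0 copq.
have [p1|p_neq1] := eqVneq p 1%N.
  rewrite p1 in copq *.
  have -> : q = 1 + (q - 1) * 1%N by ring.
  rewrite dlens_sum_shift // dedekind_sum_shift // /dedekind_sum !big_ord1.
  by rewrite /dlens (d_S3 hd) !mul0r.
have p_neq0 : p%:Z != 0 by rewrite eqz_nat -lt0n.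
have r_ge0 : 0 <= (q %% p)%Z by rewrite modz_ge0.
have [r Er] : {r : nat | (q %% p)%Z = r} by exists `|(q %% p)%Z|%N; rewrite gez0_abs.
have lt_rp : (r < p)%N by rewrite -ltz_nat -Er ltz_pmod.
have copr : coprime p r.
  by have := copq; rewrite /coprimez -gcdz_modr Er.
have r_gt0 : (0 < r)%N.
  by rewrite lt0n; apply: contra p_neq1 => /eqP r0; rewrite r0 /coprime gcdn0 in copr.
rewrite (divz_eq q p) Er addrC dlens_sum_shift // dedekind_sum_shift //.
have := dlens_sum_reciprocity p r r_gt0 lt_rp copr.
by rewrite (IH r lt_rp p) ?coprimezE 1?coprime_sym // => /addIr.
Qed.

End Lens.

Theorem corollary1p3 (T : qhs3_theory)
    (d : forall Y : T, spinc Y -> rat) (hd : is_correction_term d)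
    (lambda : T -> rat) (hlambda : is_casson_walker lambda)
    (p q : int) (hp : p != 0) (hq : q != 0) (hpq : coprimez p q) :
  1 / `|p|%:~R * (\sum_(s : spinc (lens T p q)) d (lens T p q) s)
  = lambda (lens T p q).
Proof.
have pos (m : nat) (r : int) : (0 < m)%N -> coprimez m r ->
    1 / m%:R * (\sum_(s : spinc (lens T m r)) d (lens T m r) s)
    = lambda (lens T m r).
  move=> m_gt0 comr; have m0 : m%:Z != 0 by rewrite eqz_nat -lt0n.
  rewrite sum_spinc_lens // div1r mulrC avg_dlens //.
  pose k : int := `|r|%N.+1.
  have r'_gt0 : 0 < r + k * m by rewrite /k; nia.
  rewrite -(lambda_homeo hlambda (lens_shift T k m0 comr)).
  rewrite (lambda_lens hlambda) // ?dedekind_sum_shift //.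
  by rewrite /coprimez addrC gcdzMDl.
have [m [Ep m_gt0]] : exists m : nat, (p = m \/ p = - m%:Z) /\ (0 < m)%N.
  by exists `|p|%N; lia.
case: Ep hpq => -> {p hp} copm; first by rewrite -(pos m q).
have m0 : m%:Z != 0 by rewrite eqz_nat -lt0n.
have {}copm : coprimez m q by rewrite /coprimez -gcdNz.
have h := lens_oppl T m0 copm.
rewrite (lambda_homeo hlambda h) -pos //; last by rewrite /coprimez gcdzN.
rewrite normrN (reindex _ (onW_bij _ (spinc_homeo_bij h))).
by congr (_ * _); apply: eq_bigr => s _; rewrite (d_homeo hd).
Qed.
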